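(* Let $B$ be a bialgebra over a field $k$ and let $\mathcal{C}$ be an Abelian category of finite-dimensional left $B$-modules. Then $\mathcal{C}$ is semisimple if and only if $B^*_{\mathcal{C}}$ has the Peter-Weyl decomposition $$B^*_{\mathcal{C}}=\bigoplus_{V}\beta_V(V\otimes V^* )$$ as an internal direct sum over all isomorphism classes of simple objects $V$ in $\mathcal{C}$.
   Context: For a finite-dimensional left $B$-module $V$, the matrix coefficient map is $\beta_V\colon V\otimes V^*\to B^*$, $\beta_V(v\otimes\zeta)(b)=\zeta(b\triangleright v)$. Here $B^*$ is the linear dual of $B$. $B^*_{\mathcal{C}}\subset B^*$ denotes the linear span of the images of all the maps $\beta_V$, $V\in\mathcal{C}$. The subspace $\beta_V(V\otimes V^* )$ depends only on the isomorphism class of $V$.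
   Formalization: ''Abelian category of finite-dimensional left B-modules'' is taken to be a full subcategory closed under isomorphism, finite direct sums, submodules and quotient modules, so simple objects are simple modules; with closure only under kernels, cokernels and sums the claim fails. *)

(* Defs.v *)
From HB Require Import structures.
From mathcomp Require Import all_boot all_algebra.
From mathcomp Require Import boolp classical_sets.

Set Implicit Arguments.
Unset Strict Implicit.
Unset Printing Implicit Defensive.

Import GRing.Theory.

Local Open Scope classical_set_scope.
Local Open Scope ring_scope.

(* A finite list of pairs [:: (x1, y1); ...; (xn, yn)] stands for the tensor
   x1 (x) y1 + ... + xn (x) yn.  By the universal property of the tensor
   product, two lists stand for the same tensor exactly when every bilinear
   map takes the same value on them; likewise for triples. *)
Definition tensor_eq (k : fieldType) (B : lmodType k) (s t : seq (B * B)) : Prop :=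
  forall (W : lmodType k) (f : B -> B -> W),
    (forall y, linear (f^~ y)) -> (forall x, linear (f x)) ->
    \sum_(p <- s) f p.1 p.2 = \sum_(p <- t) f p.1 p.2.

Definition tensor3_eq (k : fieldType) (B : lmodType k)
    (s t : seq (B * B * B)) : Prop :=
  forall (W : lmodType k) (f : B -> B -> B -> W),
    (forall y z, linear (fun x => f x y z)) ->
    (forall x z, linear (fun y => f x y z)) ->
    (forall x y, linear (f x y)) ->
    \sum_(p <- s) f p.1.1 p.1.2 p.2 = \sum_(p <- t) f p.1.1 p.1.2 p.2.

(* [comul x] is a choice of pairs (x_(1), x_(2)) in Sweedler's notation. *)
HB.mixin Record isBialgebra (k : fieldType) B of GRing.Algebra k B := {
  comul : B -> seq (B * B);
  counit : B -> k;
  comul_linear : forall (a : k) (x y : B),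
    tensor_eq (comul (a *: x + y))
              ([seq (a *: p.1, p.2) | p <- comul x] ++ comul y);
  comul1 : tensor_eq (comul 1) [:: (1, 1)];
  comulM : forall x y : B,
    tensor_eq (comul (x * y))
              [seq (p.1 * q.1, p.2 * q.2) | p <- comul x, q <- comul y];
  comulA : forall x : B,
    tensor3_eq [seq (q.1, q.2, p.2) | p <- comul x, q <- comul p.1]
               [seq (p.1, q.1, q.2) | p <- comul x, q <- comul p.2];
  counit_linear : forall (a : k) (x y : B),
    counit (a *: x + y) = a * counit x + counit y;
  counit1 : counit 1 = 1;
  counitM : forall x y : B, counit (x * y) = counit x * counit y;
  counitl : forall x : B, \sum_(p <- comul x) counit p.1 *: p.2 = x;
  counitr : forall x : B, \sum_(p <- comul x) counit p.2 *: p.1 = x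
}.

#[short(type="bialgType")]
HB.structure Definition Bialgebra (k : fieldType) :=
  {B of isBialgebra k B & GRing.Algebra k B}.

Definition dual (k : fieldType) (U : lmodType k) : Type := {linear U -> k^o}.

Section DualSpace.
Variables (k : fieldType) (U : lmodType k).
Implicit Types f g h : dual U.

Lemma dualP f g : f =1 g -> f = g.
Proof.
case: f g => [f [[pf] [qf]]] [g [[pg] [qg]]] /= /funext e.
rewrite /= in e; subst g.
by rewrite (Prop_irrelevance pf pg) (Prop_irrelevance qf qg).
Qed.

HB.instance Definition _ := gen_eqMixin (dual U).
HB.instance Definition _ := gen_choiceMixin (dual U).

Let dual0 : dual U := (\0 : U -> k^o).
Let dualN f : dual U := (\- f : U -> k^o).
Let dualD f g : dual U := (f \+ g : U -> k^o).
Let dualZ (a : k) f : dual U := (a \*: f : U -> k^o).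

Fact dual_addA : associative dualD.
Proof. by move=> f g h; apply: dualP => x /=; rewrite addrA. Qed.
Fact dual_addC : commutative dualD.
Proof. by move=> f g; apply: dualP => x /=; rewrite addrC. Qed.
Fact dual_add0 : left_id dual0 dualD.
Proof. by move=> f; apply: dualP => x /=; rewrite add0r. Qed.
Fact dual_addN : left_inverse dual0 dualN dualD.
Proof. by move=> f; apply: dualP => x /=; rewrite addNr. Qed.
HB.instance Definition _ :=
  GRing.isZmodule.Build (dual U) dual_addA dual_addC dual_add0 dual_addN.

Fact dual_scaleA a b f : dualZ a (dualZ b f) = dualZ (a * b) f.
Proof. by apply: dualP => x /=; rewrite scalerA. Qed.
Fact dual_scale1 : left_id 1 dualZ.
Proof. by move=> f; apply: dualP => x /=; rewrite scale1r. Qed.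
Fact dual_scaleDr : right_distributive dualZ +%R.
Proof. by move=> a f g; apply: dualP => x /=; rewrite scalerDr. Qed.
Fact dual_scaleDl f : {morph dualZ^~ f : a b / a + b}.
Proof. by move=> a b; apply: dualP => x /=; rewrite scalerDl. Qed.
HB.instance Definition _ := GRing.Zmodule_isLmodule.Build k (dual U)
  dual_scaleA dual_scale1 dual_scaleDr dual_scaleDl.
End DualSpace.

Section LinearSpans.
Variables (k : fieldType) (E : lmodType k).

Definition lspan (S : set E) : set E :=
  [set x | exists n (c : 'I_n -> k) (s : 'I_n -> E),
    (forall i, S (s i)) /\ x = \sum_(i < n) c i *: s i].

(* [U] is the internal direct sum of the subspaces [W i], [i : I]: it consists
   of the finite sums of elements of the [W i], and nonzero elements of
   distinct [W i] are linearly independent. *)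
Definition internal_direct_sum (I : Type) (U : set E) (W : I -> set E) : Prop :=
  U = [set x | exists n (j : 'I_n -> I) (w : 'I_n -> E),
        (forall i, W (j i) (w i)) /\ x = \sum_(i < n) w i] /\
  (forall n (j : 'I_n -> I) (w : 'I_n -> E),
     injective j -> (forall i, W (j i) (w i)) ->
     \sum_(i < n) w i = 0 -> forall i, w i = 0).
End LinearSpans.

Record fdmodule (k : fieldType) (B : algType k) := FdModule {
  fdspace :> vectType k;
  act : B -> fdspace -> fdspace;
  act_linear_l : forall v, linear (act^~ v);
  act_linear_r : forall b, linear (act b);
  act1 : forall v, act 1 v = v;
  actM : forall a b v, act (a * b) v = act a (act b v)
}.
Arguments act {k B} V b v : rename.

Section Modules.
Variables (k : fieldType) (B : algType k).
Implicit Types (V W : fdmodule B) (C : fdmodule B -> Prop).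

Definition is_hom V W (f : 'Hom(V, W)) : Prop :=
  forall b v, f (act V b v) = act W b (f v).

Definition embeds V W : Prop :=
  exists f : 'Hom(V, W), is_hom f /\ lker f = 0%VS.

Definition surjects V W : Prop :=
  exists f : 'Hom(V, W), is_hom f /\ limg f = fullv.

Definition isomorphic V W : Prop :=
  exists f : 'Hom(V, W), [/\ is_hom f, lker f = 0%VS & limg f = fullv].

Section Zero.
Let act0 (b : B) (v : 'rV[k]_0) : 'rV[k]_0 := 0.
Fact act0_linear_l v : linear (act0^~ v).
Proof. by move=> a x y; rewrite /act0 scaler0 addr0. Qed.
Fact act0_linear_r b : linear (act0 b).
Proof. by move=> a x y; rewrite /act0 scaler0 addr0. Qed.
Fact act0_1 v : act0 1 v = v.
Proof. by rewrite [v]thinmx0. Qed.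
Fact act0_M a b v : act0 (a * b) v = act0 a (act0 b v).
Proof. by []. Qed.
Definition zero_module : fdmodule B :=
  FdModule act0_linear_l act0_linear_r act0_1 act0_M.
End Zero.

Section DirectSum.
Variables V W : fdmodule B.
Let actD (b : B) (x : V * W) : V * W := (act V b x.1, act W b x.2).
Fact actD_linear_l x : linear (actD^~ x).
Proof.
by move=> a b c; congr (_, _);
  [apply: (@act_linear_l _ _ V) | apply: (@act_linear_l _ _ W)].
Qed.
Fact actD_linear_r b : linear (actD b).
Proof. by move=> a x y; congr (_, _); rewrite /= act_linear_r. Qed.
Fact actD_1 x : actD 1 x = x.
Proof. by case: x => v w; rewrite /actD /= !act1. Qed.
Fact actD_M a b x : actD (a * b) x = actD a (actD b x).
Proof. by rewrite /actD /= !actM. Qed.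
Definition direct_sum : fdmodule B :=
  FdModule actD_linear_l actD_linear_r actD_1 actD_M.
End DirectSum.

(* Full abelian subcategories of the category of finite-dimensional left
   B-modules, given by their classes of objects.  Being abelian is understood
   inside the ambient category: zero object, biproducts, subobjects and
   quotients are those of B-modules.  In particular simple objects are simple
   modules, without which non-isomorphic simple objects could share matrix
   coefficients.  [abelian_sub] includes closure under isomorphism. *)
Record abelian_subcategory C : Prop := AbelianSubcategory {
  abelian_zero : C zero_module;
  abelian_sum : forall V W, C V -> C W -> C (direct_sum V W);
  abelian_sub : forall V W, C V -> embeds W V -> C W;
  abelian_quo : forall V W, C V -> surjects V W -> C W
}.

Definition simple_object C V : Prop :=
  [/\ C V, ~ isomorphic V zero_module
    & forall W (f : 'Hom(W, V)), C W -> is_hom f -> lker f = 0%VS ->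
        isomorphic W zero_module \/ limg f = fullv].

Definition semisimple_category C : Prop :=
  forall V, C V -> exists n (S : 'I_n -> fdmodule B),
    (forall i, simple_object C (S i)) /\
    isomorphic V (\big[direct_sum/zero_module]_(i < n) S i).

Definition simple_isoclass C : Type :=
  {c : fdmodule B -> Prop | exists2 V, simple_object C V & c = isomorphic V}.

Section MatrixCoefficients.
Variable V : fdmodule B.

Definition matrix_coef (v : V) (zeta : 'Hom(V, k^o)) (b : B) : k^o :=
  zeta (act V b v).
Fact matrix_coef_linear v zeta : linear (matrix_coef v zeta).
Proof. by move=> a b c; rewrite /matrix_coef act_linear_l linearP. Qed.
HB.instance Definition _ v zeta := GRing.isLinear.Build k B k^o *:%R
  (matrix_coef v zeta) (matrix_coef_linear v zeta).

Definition beta (v : V) (zeta : 'Hom(V, k^o)) : dual B := matrix_coef v zeta.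

(* The image of [beta] on all of V (x) V^*: tensors are finite sums of
   v (x) zeta. *)
Definition coef_space : set (dual B) :=
  [set f | exists n (v : 'I_n -> V) (zeta : 'I_n -> 'Hom(V, k^o)),
    f = \sum_(i < n) beta (v i) (zeta i)].
End MatrixCoefficients.

Definition dual_of_category C : set (dual B) :=
  lspan [set f | exists2 V, C V & coef_space V f].

(* [coef_space] of any member of the class; it does not depend on the
   member. *)
Definition isoclass_coef_space C (c : simple_isoclass C) : set (dual B) :=
  [set f | exists2 V, sval c V & coef_space V f].

Definition peter_weyl C : Prop :=
  internal_direct_sum (dual_of_category C) (@isoclass_coef_space C).
End Modules.

(* Main.v *)
From HB Require Import structures.
Require Import Defs.
From mathcomp Require Import all_boot all_algebra.
From mathcomp Require Import boolp classical_sets.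

(** Both directions rest on how well elements of B can be prescribed on
finitely many vectors of simple modules.

Semisimple implies Peter-Weyl.  Matrix coefficients of a direct sum are sums
of matrix coefficients of the summands, so the coefficients of the simple
objects span everything.  For the independence of the coefficient spaces of
pairwise non-isomorphic simple modules V_1, ..., V_n, it is enough to have an
element e_i of B acting as 1 on V_i and as 0 on every other V_j
([separate_family]).  Given such elements, substituting
b e_i for b in a relation w_1 + ... + w_n = 0 leaves w_i(b) = 0.  For two
modules S, V the element is obtained by killing a basis of V one vector at a
time, with factors that act as 1 on S ([separate_pair]).  Such factors come from an
element that kills S but not V, which exists because otherwise S and V would be
isomorphic ([ann_sub_iso]).

Peter-Weyl implies semisimple.  Let V be in C.  The finitely many matrix
coefficients of V in a basis are sums of matrix coefficients of simple objects,
so there are finitely many vectors s_i in simple objects S_i such that an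
element of B killing all the s_i kills V.  Take a subfamily of the s_i that is
minimal with this property.  By minimality there are c_i in B with
c_i s_j = s_j if i = j, and 0 otherwise; so 1 - sum_i c_i kills V, and
v = sum_i c_i v for every v.  Moreover b s_i |-> b v is a well-defined
homomorphism S_i -> V when b runs through the left ideal killing the other s_j, so each
c_i v is in the image of a simple object ([ann_generated]).  A module generated
by images of simple objects is a direct sum of simple objects: an injective
homomorphism from such a direct sum to V can be enlarged as long as it is not
surjective ([sum_of_simples]). *)

Set Implicit Arguments.
Unset Strict Implicit.
Unset Printing Implicit Defensive.

Import GRing.Theory.

Local Open Scope ring_scope.

(** * Submodules, left ideals and irreducible modules *)

Section Modules.
Variables (k : fieldType) (B : algType k).
Implicit Types (V W X S : fdmodule B).

Lemma actBl V a b v : act V (a - b) v = act V a v - act V b v.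
Proof.
have := act_linear_l v (-1) b a.
by rewrite /= !scaleN1r [X in act V X]addrC [X in _ = X -> _]addrC.
Qed.

Lemma act0l V v : act V 0 v = 0.
Proof. by rewrite -(subrr 0) actBl subrr. Qed.

Lemma actDl V a b v : act V (a + b) v = act V a v + act V b v.
Proof. by have := act_linear_l v 1 a b; rewrite /= !scale1r. Qed.

Lemma actZl V a b v : act V (a *: b) v = a *: act V b v.
Proof. by have := act_linear_l v a b 0; rewrite /= act0l !addr0. Qed.

HB.instance Definition _ V b := GRing.isLinear.Build k V V *:%R
  (act V b) (act_linear_r b).

(** Submodules are predicates rather than subspaces because the ones that
matter, orbits of left ideals and preimages, are given by a formula;
[submodule_fdmodule] turns them into modules. *)
Definition submodule V (P : V -> Prop) : Prop :=
  [/\ P 0, forall u v, P u -> P v -> P (u + v)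
    & forall b v, P v -> P (act V b v)].

Definition left_ideal (L : B -> Prop) : Prop :=
  [/\ L 0, forall b c, L b -> L c -> L (b + c)
    & forall x b, L b -> L (x * b)].

(** The module-theoretic form of simplicity, independent of a category; it is
derived from [simple_object] in [simple_irreducible]. *)
Definition irreducible V : Prop :=
  (exists v : V, v <> 0) /\
  forall P, submodule P -> forall v : V, P v -> v <> 0 -> forall u, P u.

Lemma submoduleZ V P (a : k) v : @submodule V P -> P v -> P (a *: v).
Proof. by case=> _ _ PM Pv; rewrite -(act1 v) -actZl; apply: PM. Qed.

Lemma left_idealZ L (a : k) b : left_ideal L -> L b -> L (a *: b).
Proof. by case=> _ _ LM Lb; rewrite -(mul1r b) scalerAl; apply: LM. Qed.

Lemma left_idealB L b c : left_ideal L -> L b -> L c -> L (b - c).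
Proof.
move=> Lideal Lb Lc; case: (Lideal) => _ LD _.
by apply: LD => //; rewrite -scaleN1r; apply: left_idealZ.
Qed.

Lemma ideal_orbit_submodule V L (v : V) : left_ideal L ->
  submodule (fun u : V => exists2 b, L b & act V b v = u).
Proof.
case=> L0 LD LM; split.
- by exists 0 => //; rewrite act0l.
- move=> _ _ [b Lb <-] [c Lc <-].
  by exists (b + c); [apply: LD | rewrite actDl].
- move=> x _ [b Lb <-].
  by exists (x * b); [apply: LM | rewrite actM].
Qed.

(** The orbit L v is a submodule; if it is not zero, it is everything. *)
Lemma irreducible_orbit V L (v : V) b : irreducible V -> left_ideal L ->
  L b -> act V b v <> 0 -> forall u, exists2 c, L c & act V c v = u.
Proof.
case=> _ Virr Lideal Lb bv0.
by apply: (Virr _ (ideal_orbit_submodule v Lideal)) bv0; exists b.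
Qed.

(** A subspace of maximal dimension among those contained in P is all of P:
any vector of P outside it could be added. *)
Lemma subspace_of_pred (E : vectType k) (P : E -> Prop) : P 0 ->
  (forall (a : k) u v, P u -> P v -> P (a *: u + v)) ->
  exists U : {vspace E}, forall v, v \in U <-> P v.
Proof.
move=> P0 PL.
pose Q d :=
  `[< exists U : {vspace E}, \dim U = d /\ forall v, v \in U -> P v >].
have exQ : exists d, Q d.
  exists 0%N; apply/asboolP; exists 0%VS; split; first by rewrite dimv0.
  by move=> v; rewrite memv0 => /eqP ->.
have bQ d : Q d -> (d <= \dim {:E})%N.
  by move=> /asboolP [U [<- _]]; apply/dimvS/subvf.
case: (ex_maxnP exQ bQ) => d /asboolP [U [dU UP]] dmax.
exists U => v; split; first exact: UP.
move=> Pv; apply: contrapT => /negP vU.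
have : (\dim (U + <[v]>)%VS <= d)%N.
  apply/dmax/asboolP; exists (U + <[v]>)%VS; split=> // w.
  case/memv_addP=> u uU [_ /vlineP [a ->] ->].
  by rewrite addrC; apply: PL => //; apply: UP.
apply/negP; rewrite -ltnNge -dU ltnNge; apply/negP => le.
have /eqP UE : U == (U + <[v]>)%VS by rewrite eqEdim addvSl.
by case/negP: vU; rewrite UE; apply/(subvP (addvSr _ _))/memv_line.
Qed.

Lemma submodule_fdmodule V P : @submodule V P ->
  exists (W : fdmodule B) (f : 'Hom(W, V)),
    [/\ is_hom f, lker f = 0%VS & forall v, v \in limg f <-> P v].
Proof.
move=> Psub; case: (Psub) => P0 PD PM.
have [|U UP] := subspace_of_pred P0.
  by move=> a u v Pu Pv; apply: PD => //; apply: submoduleZ.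
pose aU (b : B) (w : subvs_of U) : subvs_of U := vsproj U (act V b (vsval w)).
have aUE b w : vsval (aU b w) = act V b (vsval w).
  by rewrite vsprojK //; apply/UP/PM/UP/subvsP.
have vI : injective (@vsval k V U) by exact: val_inj.
have a1 w : linear (aU^~ w).
  by move=> a x y; apply: vI; rewrite linearP /= !aUE actDl actZl.
have a2 b : linear (aU b).
  by move=> a x y; apply: vI; rewrite linearP /= !aUE !linearP.
have a3 w : aU 1 w = w by apply: vI; rewrite aUE act1.
have a4 a b w : aU (a * b) w = aU a (aU b w).
  by apply: vI; rewrite !aUE actM.
exists (FdModule a1 a2 a3 a4), (linfun vsval); split.
- by move=> b w; rewrite !lfunE /= aUE.
- apply/eqP/lker0P => x y; rewrite !lfunE; exact: val_inj.
- move=> v; rewrite -UP; split.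
    by case/memv_imgP=> w _ ->; rewrite lfunE; apply: subvsP.
  move=> vU; apply/memv_imgP; exists (vsproj U v); rewrite ?memvf //.
  by rewrite lfunE /= vsprojK.
Qed.

(** * Homomorphisms and Schur's lemma *)

Lemma is_hom_comp V W X (f : 'Hom(V, W)) (g : 'Hom(W, X)) :
  is_hom f -> is_hom g -> is_hom (g \o f)%VF.
Proof. by move=> hf hg b v; rewrite !comp_lfunE hf hg. Qed.

Lemma is_hom_inv V W (f : 'Hom(V, W)) : is_hom f -> lker f = 0%VS ->
  limg f = fullv -> [/\ is_hom f^-1%VF, cancel f f^-1%VF & cancel f^-1%VF f].
Proof.
move=> hf /eqP kf If; have fK := lker0_lfunK kf.
have Kf : cancel f^-1%VF f by move=> w; apply: limg_lfunVK; rewrite If memvf.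
by split=> // b w; rewrite -{1}(Kf w) -hf fK.
Qed.

Lemma cancel_iso V W (f : 'Hom(V, W)) (g : 'Hom(W, V)) :
  is_hom f -> cancel f g -> cancel g f -> isomorphic V W.
Proof.
move=> hf fK gK; exists f; split=> //.
  by apply/eqP/lker0P/(can_inj fK).
by apply/vspaceP => w; rewrite memvf; apply/memv_imgP;
  exists (g w); rewrite ?memvf ?gK.
Qed.

Lemma isomorphic_refl V : isomorphic V V.
Proof.
by apply: (@cancel_iso _ _ \1%VF \1%VF) => [b v|v|v]; rewrite !id_lfunE.
Qed.

Lemma isomorphic_sym V W : isomorphic V W -> isomorphic W V.
Proof.
case=> f [hf kf If]; case: (is_hom_inv hf kf If) => hg fK gK.
exact: cancel_iso gK fK.
Qed.

Lemma isomorphic_trans V W X :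
  isomorphic V W -> isomorphic W X -> isomorphic V X.
Proof.
case=> f [hf kf If] [g [hg kg Ig]].
have [hf' fK Kf] := is_hom_inv hf kf If; have [hg' gK Kg] := is_hom_inv hg kg Ig.
apply: (@cancel_iso _ _ (g \o f)%VF (f^-1 \o g^-1)%VF (is_hom_comp hf hg)).
  by move=> x; rewrite !comp_lfunE gK fK.
by move=> x; rewrite !comp_lfunE Kf Kg.
Qed.

Lemma irreducible_ker S V (f : 'Hom(S, V)) : irreducible S -> is_hom f ->
  forall s, f s <> 0 -> lker f = 0%VS.
Proof.
move=> [_ Sirr] hf s fs0; apply/eqP/lker0P => x y fxy.
apply: contrapT => xy; apply: fs0.
apply: (Sirr (fun s => f s = 0) _ (x - y)).
- split=> [|u v fu fv|b v fv]; first by rewrite linear0.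
    by rewrite linearD /= fu fv addr0.
  by rewrite hf fv linear0.
- by rewrite linearB /= fxy subrr.
- by move/eqP; rewrite subr_eq0 => /eqP.
Qed.

Lemma limg_submodule V W (f : 'Hom(V, W)) : is_hom f ->
  submodule (fun w => w \in limg f).
Proof.
move=> hf; split; [exact: mem0v | by move=> ??; apply: memvD | ].
move=> b _ /memv_imgP [v _ ->]; rewrite -hf; exact/memv_img/memvf.
Qed.

Lemma irreducible_iso S V (f : 'Hom(S, V)) : irreducible S -> irreducible V ->
  is_hom f -> forall s, f s <> 0 -> isomorphic S V.
Proof.
move=> Sirr [_ Virr] hf s fs0; exists f; split=> //.
  exact: irreducible_ker fs0.
apply/vspaceP => v; rewrite memvf.
by apply: (Virr _ (limg_submodule hf)) fs0 v; apply/memv_img/memvf.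
Qed.

(** The homomorphism sends b s to b v, for b in L.  Its values are defined
on all of S because L s = S, and they are well defined by the last
hypothesis. *)
Lemma hom_of_ideal S V L (s : S) (v : V) b0 :
  irreducible S -> left_ideal L -> L b0 -> act S b0 s <> 0 ->
  (forall b, L b -> act S b s = 0 -> act V b v = 0) ->
  exists2 f : 'Hom(S, V), is_hom f & forall b, L b -> f (act S b s) = act V b v.
Proof.
move=> Sirr Lideal Lb0 b0s kerL; case: (Lideal) => L0 LD LM.
have [c cP] : {c : S -> B & forall u, L (c u) /\ act S (c u) s = u}.
  apply: (@choice _ _ (fun u b => L b /\ act S b s = u)) => u.
  by have [x Lx <-] := irreducible_orbit Sirr Lideal Lb0 b0s u; exists x.
have wd b u : L b -> act S b s = u -> act V (c u) v = act V b v.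
  have [Lc cs] := cP u; move=> Lb bs; apply/eqP; rewrite -subr_eq0 -actBl.
  by apply/eqP/kerL; [apply: left_idealB | rewrite actBl cs bs subrr].
pose f0 u := act V (c u) v.
have f0L : linear f0.
  move=> a x y; rewrite /f0 -actZl -actDl.
  have [[Lx xs] [Ly ys]] := (cP x, cP y); apply: wd.
    by apply: LD => //; apply: left_idealZ.
  by rewrite actDl actZl xs ys.
pose f0' := GRing.isLinear.Build k S V *:%R f0 f0L.
pose f1 : {linear S -> V} := HB.pack f0 f0'.
have f1E u : linfun f1 u = act V (c u) v by rewrite lfunE.
exists (linfun f1).
  move=> b u; rewrite !f1E -actM; have [Lu us] := cP u.
  by apply: wd; [apply: LM | rewrite actM us].
by move=> b Lb; rewrite f1E; apply: wd.
Qed.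

(** * Modules generated by images of irreducible modules *)

(** The module V is a subquotient of a sum of copies of the S_i, hence a
quotient of one.  Working with a minimal set A of vectors s_i gives the
homomorphisms S_i -> V directly: for i in A, some c_i in B fixes s_i and kills
the other s_j, and the sum of the c_i acts as 1 on V. *)
Lemma ann_generated (I : finType) (S : I -> fdmodule B) (s : forall i, S i)
    V (U : {vspace V}) :
  (forall i, irreducible (S i)) ->
  (forall b, (forall i, act (S i) b (s i) = 0) -> forall v, act V b v = 0) ->
  (forall i (f : 'Hom(S i, V)), is_hom f -> forall u, f u \in U) ->
  U = fullv.
Proof.
move=> Sirr annV homU.
pose ann (A : {set I}) b := forall i, i \in A -> act (S i) b (s i) = 0.
pose P (A : {set I}) := `[< forall b, ann A b -> forall v, act V b v = 0 >].
have PT : P finset.setT.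
  by apply/asboolP => b bT; apply: annV => i; apply: bT; rewrite inE.
have [A /minsetP [/asboolP PA Amin] _] := minset_exists PT.
have annL D : left_ideal (ann D).
  split=> [i _|b c hb hc i Di|x b hb i Di]; first by rewrite act0l.
    by rewrite actDl hb // hc // addr0.
  by rewrite actM hb // linear0.
have annA (i : I) b : ann (A :\ i) b -> act (S i) b (s i) = 0 -> ann A b.
  move=> hb bi j Aj; case: (eqVneq j i) => [->//|ji].
  by apply: hb; rewrite !inE ji.
have [c cP] : {c : I -> B & forall i, i \in A ->
    ann (A :\ i) (c i) /\ act (S i) (c i) (s i) = s i}.
  apply: (@choice _ _ (fun i b => i \in A ->
    ann (A :\ i) b /\ act (S i) b (s i) = s i)) => i.
  case: (boolP (i \in A)) => [Ai|]; last by exists 0.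
  have [b hb bi] : exists2 b, ann (A :\ i) b & act (S i) b (s i) <> 0.
    (* Otherwise s_i could be removed from the minimal set A. *)
    apply: contrapT => none.
    have : A :\ i = A.
      apply: Amin; last exact: finset.subsetDl.
      apply/asboolP => b hb; apply: PA; apply: (annA i _ hb).
      by apply: contrapT => bi; apply: none; exists b.
    by move/setP/(_ i); rewrite !inE eqxx Ai.
  by have [d hd di] := irreducible_orbit (Sirr i) (annL _) hb bi (s i); exists d.
apply/vspaceP => v; rewrite memvf.
have -> : v = \sum_(i in A) act V (c i) v.
  pose e := 1 - \sum_(i in A) c i.
  have actSl (W : fdmodule B) w :
      act W (\sum_(i in A) c i) w = \sum_(i in A) act W (c i) w.
    by apply: (big_morph (act W ^~ w)) => [x y|]; [exact: actDl|exact: act0l].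
  have /PA/(_ v) : ann A e.
    move=> j Aj; rewrite actBl act1 actSl (bigD1 j) //= big1 ?addr0.
      by have [_ ->] := cP j Aj; rewrite subrr.
    move=> i /andP [Ai ij]; have [hc _] := cP i Ai.
    by apply: hc; rewrite !inE eq_sym ij.
  by rewrite actBl act1 actSl => /eqP; rewrite subr_eq0 => /eqP.
apply: memv_suml => i Ai; have [hc ci] := cP i Ai.
have [s0|si0] := pselect (s i = 0).
  by rewrite PA ?mem0v //; apply: annA hc _; rewrite s0 linear0.
have [|b hb bi|f hf fE] := hom_of_ideal (v := v) (Sirr i) (annL _) hc (s := s i).
- by rewrite ci.
- by apply: PA; apply: annA hb _.
- by rewrite -fE //; apply: homU.
Qed.

Lemma act_basis V b : (forall i : 'I_(\dim {:V}), act V b (vbasis {:V})`_i = 0) ->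
  forall v, act V b v = 0.
Proof.
move=> hb v; rewrite (coord_vbasis (memvf v)) linear_sum big1 // => i _.
by rewrite linearZ /= hb scaler0.
Qed.

(** A nonzero homomorphism S -> V must exist, since images of S generate V. *)
Lemma ann_sub_iso S V : irreducible S -> irreducible V ->
  (forall b, (forall s, act S b s = 0) -> forall v, act V b v = 0) ->
  isomorphic S V.
Proof.
move=> Sirr Virr annS; apply: contrapT => noniso.
have [[v v0] _] := Virr; apply: v0.
suff U0 : 0%VS = fullv :> {vspace V}.
  by apply/eqP; rewrite -memv0 U0 memvf.
apply: (@ann_generated _ (fun _ : 'I_(\dim {:S}) => S)
          (fun i => (vbasis {:S})`_i)) => //.
  by move=> b hb; apply/annS/act_basis.
move=> _ f hf u; rewrite memv0; apply: contraT => /eqP fu.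
by case: noniso; apply: irreducible_iso fu.
Qed.

(** * Separating non-isomorphic irreducible modules *)

(** If b kills S but not V, then for each nonzero v some element y b x fixes v and
kills S, so 1 - y b x acts as 1 on S and kills v.  Elements acting as 1 on S
are stable under products, and a product of them kills the vectors of a basis
of V in turn. *)
Lemma separate_pair S V : irreducible S -> irreducible V -> ~ isomorphic S V ->
  exists e, (forall s, act S e s = s) /\ (forall v, act V e v = 0).
Proof.
move=> Sirr Virr noniso.
have [b bS [v0 bv0]] : exists2 b, forall s, act S b s = 0
    & exists v, act V b v <> 0.
  apply: contrapT => none; apply: noniso; apply: ann_sub_iso => // b bS v.
  by apply: contrapT => bv; apply: none; exists b => //; exists v.
(* x moves v to a vector not killed by b, and y brings the result back. *)
have kill1 v : exists e, (forall s, act S e s = s) /\ act V e v = 0.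
  have [v_0|vn0] := pselect (v = 0).
    by exists 1; split=> [s|]; rewrite act1.
  have [x _ xv] : exists2 x, True & act V x v = v0.
    by apply: (irreducible_orbit (b := 1)) => //; rewrite act1.
  have [y _ yv] : exists2 y, True & act V y (act V b v0) = v.
    by apply: (irreducible_orbit (b := 1)) => //; rewrite act1.
  exists (1 - y * b * x); split=> [s|].
    by rewrite actBl act1 !actM bS linear0 subr0.
  by rewrite actBl act1 !actM xv yv subrr.
have kill (r : seq V) : exists e,
    (forall s, act S e s = s) /\ (forall v, v \in r -> act V e v = 0).
  elim: r => [|v r [e [eS er]]]; first by exists 1; split=> [s|//]; rewrite act1.
  have [d [dS dv]] := kill1 (act V e v).
  exists (d * e); split=> [s|u]; first by rewrite actM eS dS.
  by rewrite inE actM => /orP [/eqP -> //|/er ->]; rewrite linear0.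
have [e [eS eV]] := kill (vbasis {:V}).
exists e; split=> //; apply: act_basis => i; apply: eV.
by apply: mem_nth; rewrite size_tuple.
Qed.

Lemma separate_family n (V : 'I_n -> fdmodule B) i :
  (forall j, irreducible (V j)) ->
  (forall j, j != i -> ~ isomorphic (V i) (V j)) ->
  exists e, (forall v, act (V i) e v = v) /\
            (forall j, j != i -> forall v, act (V j) e v = 0).
Proof.
move=> Virr noniso.
(* The product of the elements separating V i from each V j. *)
suff [e [ei ej]] : exists e, (forall v, act (V i) e v = v) /\
    (forall j, j \in enum 'I_n -> j != i -> forall v, act (V j) e v = 0).
  by exists e; split=> // j ji v; apply: ej; rewrite ?mem_enum.
elim: (enum 'I_n) => [|j r [e [ei er]]].
  by exists 1; split=> [v|//]; rewrite act1.
have [->|ji] := eqVneq j i.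
  exists e; split=> // l; rewrite inE => /orP [/eqP ->|]; first by rewrite eqxx.
  exact: er.
have [d [di dj]] := separate_pair (Virr i) (Virr j) (noniso j ji).
exists (d * e); split=> [v|l]; first by rewrite actM ei di.
rewrite inE => /orP [/eqP -> _|lr li] v; rewrite actM; first exact: dj.
by rewrite er // linear0.
Qed.

End Modules.

(** * Homomorphisms to and from a direct sum *)

Section DirectSumInjections.
Variables (k : fieldType) (B : algType k) (S W : fdmodule B).

Let inl0 (x : S) : direct_sum S W := (x, 0).
Let inr0 (y : W) : direct_sum S W := (0, y).

Fact inl0_linear : linear inl0.
Proof. by move=> a x y; congr (_, _); rewrite /= scaler0 addr0. Qed.
Fact inr0_linear : linear inr0.
Proof. by move=> a x y; congr (_, _); rewrite /= scaler0 addr0. Qed.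
HB.instance Definition _ :=
  GRing.isLinear.Build k S (direct_sum S W) *:%R inl0 inl0_linear.
HB.instance Definition _ :=
  GRing.isLinear.Build k W (direct_sum S W) *:%R inr0 inr0_linear.

Definition inl_hom : 'Hom(S, direct_sum S W) := linfun inl0.
Definition inr_hom : 'Hom(W, direct_sum S W) := linfun inr0.

Lemma inl_homE x : inl_hom x = (x, 0). Proof. by rewrite lfunE. Qed.
Lemma inr_homE y : inr_hom y = (0, y). Proof. by rewrite lfunE. Qed.

End DirectSumInjections.

Section DirectSumHom.
Variables (k : fieldType) (B : algType k) (S W V : fdmodule B).
Variables (g : 'Hom(S, V)) (f : 'Hom(W, V)).

Let copair (x : direct_sum S W) : V := g x.1 + f x.2.

Fact copair_linear : linear copair.
Proof.
move=> a x y; rewrite /copair /= !linearP /= scalerDr -!addrA.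
by congr (_ + _); rewrite addrCA.
Qed.
HB.instance Definition _ :=
  GRing.isLinear.Build k (direct_sum S W) V *:%R copair copair_linear.

Definition copairing : 'Hom(direct_sum S W, V) := linfun copair.

Lemma copairingE x : copairing x = g x.1 + f x.2.
Proof. by rewrite lfunE. Qed.

Lemma is_hom_copairing : is_hom g -> is_hom f -> is_hom copairing.
Proof. by move=> hg hf b x; rewrite !copairingE hg hf linearD. Qed.

(** The preimage by g of the image of f is a proper submodule of the
irreducible module S, hence zero; so the two images are independent. *)
Lemma copairing_inj : irreducible S -> is_hom g -> is_hom f ->
  lker f = 0%VS -> forall u, g u \notin limg f -> lker copairing = 0%VS.
Proof.
move=> [_ Sirr] hg hf kf u gu; apply/eqP; rewrite -subv0; apply/subvP => x.
rewrite memv_ker copairingE memv0 => /eqP gf0.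
have x10 : x.1 = 0.
  apply: contrapT => x1n0; case/negP: gu.
  have [P0 PD PM] := limg_submodule hf.
  apply: (Sirr (fun s => g s \in limg f) _ x.1) => //.
  - split=> [|s t gs gt|b s gs]; first by rewrite linear0.
      by rewrite linearD /=; apply: PD.
    by rewrite hg; apply: PM.
  - have -> : g x.1 = f (- x.2).
      by rewrite linearN; apply/eqP; rewrite -addr_eq0 gf0.
    exact/memv_img/memvf.
have x20 : x.2 = 0.
  move: gf0; rewrite x10 linear0 add0r => fx2; apply/eqP.
  by rewrite -memv0 -kf memv_ker fx2.
by case: x x10 x20 {gf0} => x1 x2 /= -> ->.
Qed.

Lemma limg_copairing_lt u : g u \notin limg f ->
  (\dim (limg f) < \dim (limg copairing))%N.
Proof.
move=> gu; have fh : (limg f <= limg copairing)%VS.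
  apply/subvP => _ /memv_imgP [y _ ->].
  have -> : f y = copairing (0, y) by rewrite copairingE linear0 add0r.
  exact/memv_img/memvf.
rewrite ltnNge; apply: contra gu => le.
have /eqP -> : limg f == limg copairing by rewrite eqEdim fh.
have -> : g u = copairing (u, 0) by rewrite copairingE linear0 addr0.
exact/memv_img/memvf.
Qed.

End DirectSumHom.

(** * Simple objects and sums of simple objects *)

Section Category.
Variables (k : fieldType) (B : algType k) (C : fdmodule B -> Prop).
Hypothesis hC : abelian_subcategory C.
Implicit Types (V W X S : fdmodule B).

Lemma zero_module_eq (x y : zero_module B) : x = y.
Proof. exact: etrans (@thinmx0 _ _ x) (esym (@thinmx0 _ _ y)). Qed.

Lemma isomorphic_zero V : (forall v : V, v = 0) -> isomorphic V (zero_module B).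
Proof.
move=> V0; apply: (@cancel_iso _ _ _ _ 0 0) => [b v|v|v].
- by rewrite !lfunE.
- exact: etrans (V0 _) (esym (V0 _)).
- exact: zero_module_eq.
Qed.

(** A submodule of an object of C is again in C, so a simple object has no
proper nonzero submodule at all. *)
Lemma simple_irreducible V : simple_object C V -> irreducible V.
Proof.
case=> CV Vn0 Vsub; split.
  apply: contrapT => none; apply/Vn0/isomorphic_zero => v.
  by apply: contrapT => v0; apply: none; exists v.
move=> P Psub v Pv v0 u.
have [W [f [hf kf fP]]] := submodule_fdmodule Psub.
have CW : C W by apply: (abelian_sub hC) CV _; exists f.
case: (Vsub W f CW hf kf) => [[g [_ kg _]]|If]; last by apply/fP; rewrite If memvf.
case: v0; have /fP/memv_imgP [w _ ->] := Pv.
move/eqP/lker0P: kg => ginj.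
have -> : w = 0 by apply: ginj; apply: zero_module_eq.
by rewrite linear0.
Qed.

(** Simple objects are added to an embedded direct sum until its image is
everything: by the generation hypothesis, as long as the image is proper, some
homomorphism from an S_i has an image not contained in it. *)
Lemma sum_of_simples V (I : finType) (S : I -> fdmodule B) :
  (forall i, simple_object C (S i)) ->
  (forall U : {vspace V},
     (forall i (f : 'Hom(S i, V)), is_hom f -> forall u, f u \in U) ->
     U = fullv) ->
  exists n (S' : 'I_n -> fdmodule B), (forall i, simple_object C (S' i)) /\
    isomorphic V (\big[@direct_sum _ _/zero_module B]_(i < n) S' i).
Proof.
move=> Ssimple gen.
pose emb d X := exists f : 'Hom(X, V),
  [/\ is_hom f, lker f = 0%VS & (d <= \dim (limg f))%N].
have grow d : (d <= \dim {:V})%N ->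
    exists n (S' : 'I_n -> fdmodule B), (forall i, simple_object C (S' i)) /\
    emb d (\big[@direct_sum _ _/zero_module B]_(i < n) S' i).
  elim: d => [_|d IHd ltd].
    exists 0%N, (fun _ => zero_module B); split; first by case.
    rewrite big_ord0; exists 0; split=> //.
      by move=> b v; rewrite !lfunE /= linear0.
    by apply/eqP/lker0P => x y _; apply: zero_module_eq.
  have [n [S' [S's]]] := IHd (ltnW ltd).
  set X := \big[_/_]_(_ < n) _ => -[f [hf kf df]].
  have [If|nIf] := eqVneq (limg f) fullv.
    by exists n, S'; split=> //; exists f; split=> //; rewrite If.
  have [i [g [hg [u gu]]]] : exists i (g : 'Hom(S i, V)),
      is_hom g /\ exists u, g u \notin limg f.
    apply: contrapT => none; move/eqP: nIf; apply; apply: gen => i g hg u.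
    by apply: contraT => gu; case: none; exists i, g; split=> //; exists u.
  exists n.+1, (fun l => if unlift ord0 l is Some j then S' j else S i); split.
    by move=> l; case: unliftP.
  rewrite big_ord_recl unlift_none; under eq_bigr do rewrite liftK.
  exists (copairing g f); split; first exact: is_hom_copairing.
    by apply: (copairing_inj _ hg hf kf gu); apply: simple_irreducible.
  exact: leq_ltn_trans df (limg_copairing_lt gu).
have [n [S' [S's [f [hf kf df]]]]] := grow _ (leqnn _).
exists n, S'; split=> //; apply: isomorphic_sym; exists f; split=> //.
by apply/eqP; rewrite eqEdim subvf.
Qed.

(** * Matrix coefficients *)

Lemma dual_sumE (I : finType) (F : I -> dual B) b :
  (\sum_i F i : dual B) b = \sum_i F i b.
Proof. by apply: (big_morph (fun f : dual B => f b)). Qed.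

Lemma coef_spaceE V f : coef_space V f ->
  exists n (v : 'I_n -> V) (zeta : 'I_n -> 'Hom(V, k^o)),
  forall b, f b = \sum_i zeta i (act V b (v i)).
Proof.
by case=> n [v [zeta ->]]; exists n, v, zeta => b; rewrite dual_sumE.
Qed.

Lemma coef_space_beta V (v : V) (zeta : 'Hom(V, k^o)) :
  coef_space V (beta v zeta).
Proof.
by exists 1%N, (fun _ => v), (fun _ => zeta); rewrite big_ord1.
Qed.

Lemma coef_space0 V : coef_space V 0.
Proof. by exists 0%N, (fun _ => 0), (fun _ => 0); rewrite big_ord0. Qed.

Lemma coef_spaceZ V (a : k) f : coef_space V f -> coef_space V (a *: f).
Proof.
case=> n [v [zeta ->]]; exists n, (fun i => a *: v i), zeta.
rewrite scaler_sumr; apply: eq_bigr => i _; apply: dualP => b /=.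
by rewrite /beta /= /matrix_coef !linearZ.
Qed.

Lemma iso_coef_space V W f : isomorphic V W -> coef_space V f -> coef_space W f.
Proof.
case=> h [hh kh Ih]; have [hg hK _] := is_hom_inv hh kh Ih.
case=> n [v [zeta ->]].
exists n, (fun i => h (v i)), (fun i => (zeta i \o h^-1)%VF).
apply: eq_bigr => i _; apply: dualP => b /=.
by rewrite /beta /= /matrix_coef comp_lfunE -hh hK.
Qed.

(** The coefficients of a direct sum are sums of coefficients of the
summands, as (v, w) (x) zeta has the same coefficient as the sum of
v (x) (zeta o inl) and w (x) (zeta o inr). *)
Lemma coef_space_big (T : dual B -> Prop) n (S : 'I_n -> fdmodule B) :
  T 0 -> (forall f g, T f -> T g -> T (f + g)) ->
  (forall i f, coef_space (S i) f -> T f) ->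
  forall f, coef_space (\big[@direct_sum _ _/zero_module B]_(i < n) S i) f -> T f.
Proof.
move=> T0 TD; elim: n S => [|n IHn] S ST f.
  rewrite big_ord0 => -[n [v [zeta ->]]]; rewrite big1 // => i _.
  by apply: dualP => b; rewrite /beta /= /matrix_coef (zero_module_eq (v i) 0) !linear0.
rewrite big_ord_recl; set X := \big[_/_]_(_ < n) _.
have TX : forall g, coef_space X g -> T g by apply: IHn => i; apply: ST.
case=> n' [v [zeta ->]]; elim/big_ind: _ => // i _.
have -> : beta (v i) (zeta i) = beta (v i).1 (zeta i \o inl_hom _ _)%VF
                              + beta (v i).2 (zeta i \o inr_hom _ _)%VF.
  apply: dualP => b /=; rewrite /beta /= /matrix_coef !comp_lfunE inl_homE inr_homE.
  rewrite -linearD; congr (zeta i _).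
  by congr (_, _); rewrite /= ?addr0 ?add0r.
by apply: TD; [apply: (ST ord0)|apply: TX]; apply: coef_space_beta.
Qed.

Lemma coef_space_unit V f e : coef_space V f ->
  (forall v, act V e v = v) -> forall b, f (b * e) = f b.
Proof.
move=> /coef_spaceE [n [v [zeta fE]]] eV b; rewrite !fE.
by apply: eq_bigr => i _; rewrite actM eV.
Qed.

Lemma coef_space_kill V f e : coef_space V f ->
  (forall v, act V e v = 0) -> forall b, f (b * e) = 0.
Proof.
move=> /coef_spaceE [n [v [zeta fE]]] eV b; rewrite !fE.
by rewrite big1 // => i _; rewrite actM eV !linear0.
Qed.

Lemma isoclass_rep (c : simple_isoclass C) : exists X,
  [/\ simple_object C X, sval c = isomorphic X
    & forall f, isoclass_coef_space c f -> coef_space X f].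
Proof.
case: c => c [X Xs cX]; exists X; split=> // f [W /= cW].
by apply: iso_coef_space; apply: isomorphic_sym; rewrite -cX.
Qed.

(** * Independence of the coefficient spaces *)

(** Right multiplication of the argument by an element acting as 1 on the i-th
module and as 0 on the others isolates w_i in the relation. *)
Lemma isoclass_independent n (j : 'I_n -> simple_isoclass C) (w : 'I_n -> dual B) :
  injective j -> (forall i, isoclass_coef_space (j i) (w i)) ->
  \sum_(i < n) w i = 0 -> forall i, w i = 0.
Proof.
move=> j_inj jw w0 i.
have [X XP] := choice (fun l => isoclass_rep (j l)).
have Xnoniso l : l != i -> ~ isomorphic (X i) (X l).
  move=> li il; case/negP: li; apply/eqP/j_inj.
  have [[_ cl _] [_ ci _]] := (XP l, XP i).
  apply: eq_sig_hprop => [c p q|]; first exact: Prop_irrelevance.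
  rewrite cl ci; apply/funext => W; apply/propext; split=> [lW|iW].
    exact: isomorphic_trans lW.
  by apply: isomorphic_trans iW; apply: isomorphic_sym.
have [|e [ei el]] := separate_family _ Xnoniso.
  by move=> l; apply: simple_irreducible; have [] := XP l.
have wX l : coef_space (X l) (w l) by have [_ _] := XP l; apply.
apply: dualP => b.
have := congr1 (fun f : dual B => f (b * e)) w0.
rewrite dual_sumE (bigD1 i) //= (coef_space_unit (wX i) ei) big1 ?addr0 //.
by move=> l li; apply: coef_space_kill (el l li) b.
Qed.

(** * Sums of coefficients of simple objects *)

Definition isoclass_sums : dual B -> Prop := fun x =>
  exists n (j : 'I_n -> simple_isoclass C) (w : 'I_n -> dual B),
  (forall i, isoclass_coef_space (j i) (w i)) /\ x = \sum_(i < n) w i.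

Lemma isoclass_sums0 : isoclass_sums 0.
Proof.
exists 0%N, (fun i : 'I_0 => False_rect _ (notF (ltn_ord i))), (fun _ => 0).
by rewrite big_ord0; split=> //; case.
Qed.

Lemma isoclass_sumsD f g :
  isoclass_sums f -> isoclass_sums g -> isoclass_sums (f + g).
Proof.
move=> [n [j [w [jw ->]]]] [n' [j' [w' [jw' ->]]]].
exists (n + n')%N, (fun i => match split i with inl l => j l | inr l => j' l end),
  (fun i => match split i with inl l => w l | inr l => w' l end).
split=> [i|]; first by case: (split i).
rewrite big_split_ord /=; congr (_ + _); apply: eq_bigr => i _.
  by rewrite (unsplitK (inl i)).
by rewrite (unsplitK (inr i)).
Qed.

Lemma isoclass_sumsZ (a : k) f : isoclass_sums f -> isoclass_sums (a *: f).
Proof.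
move=> [n [j [w [jw ->]]]]; exists n, j, (fun i => a *: w i).
split; last by rewrite scaler_sumr.
by move=> i; case: (jw i) => V cV /(coef_spaceZ a) aw; exists V.
Qed.

Lemma isoclass_sums_simple V f :
  simple_object C V -> coef_space V f -> isoclass_sums f.
Proof.
move=> Vs Vf; pose c : simple_isoclass C :=
  exist _ (isomorphic V) (ex_intro2 _ _ V Vs erefl).
exists 1%N, (fun _ => c), (fun _ => f); rewrite big_ord1; split=> // _.
by exists V => //=; apply: isomorphic_refl.
Qed.

Lemma isoclass_sums_sub f : isoclass_sums f -> dual_of_category C f.
Proof.
move=> [n [j [w [jw ->]]]]; exists n, (fun _ => 1), w; split.
  move=> i; have [X [[CX _ _] _ Xw]] := isoclass_rep (j i).
  by exists X => //; apply: Xw.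
by apply: eq_bigr => i _; rewrite scale1r.
Qed.

(** * The two implications *)

Lemma semisimple_peter_weyl : semisimple_category C -> peter_weyl C.
Proof.
move=> ss; split; last exact: isoclass_independent.
apply/seteqP; split=> f; last exact: isoclass_sums_sub.
case=> n [a [s [sC ->]]].
apply: (@big_ind _ isoclass_sums) => [||i _].
- exact: isoclass_sums0.
- exact: isoclass_sumsD.
apply: isoclass_sumsZ; have [V CV Vs] := sC i.
have [m [S [Ss /iso_coef_space/(_ Vs)]]] := ss V CV.
apply: coef_space_big => [||l g]; first exact: isoclass_sums0.
  exact: isoclass_sumsD.
exact: isoclass_sums_simple.
Qed.

(** Bundling the index type lets families with different index types, one for
each matrix coefficient, be chosen and put together. *)
Record simple_family := SimpleFamily {
  sf_index : finType;
  sf_module : sf_index -> fdmodule B;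
  sf_elt : forall i, sf_module i;
  sf_simple : forall i, simple_object C (sf_module i)
}.

Definition sf_ann (F : simple_family) (b : B) : Prop :=
  forall i : sf_index F, act (sf_module i) b (sf_elt i) = 0.

(** Properties of this kind pass from the vanishing of one matrix coefficient
to the vanishing of a sum of them, and from the matrix coefficients of V to the
action on V. *)
Definition implied_by_ann (P : B -> Prop) : Prop :=
  exists F, forall b, sf_ann F b -> P b.

(** Finitely many such families have a disjoint union, indexed by pairs. *)
Lemma implied_by_ann_all (J : finType) (P : J -> B -> Prop) :
  (forall j, implied_by_ann (P j)) -> implied_by_ann (fun b => forall j, P j b).
Proof.
move=> /choice [F FP].
pose I := {j : J & sf_index (F j)}.
exists (@SimpleFamily I (fun i => sf_module (tagged i))
  (fun i => sf_elt (tagged i)) (fun i => sf_simple (tagged i))).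
by move=> b hb j; apply: FP => i; exact: (hb (Tagged (fun j => sf_index (F j)) i)).
Qed.

Lemma coef_space_ann V f : simple_object C V -> coef_space V f ->
  implied_by_ann (fun b => f b = 0).
Proof.
move=> Vs /coef_spaceE [n [v [zeta fE]]].
exists (@SimpleFamily 'I_n (fun _ => V) v (fun _ => Vs)) => b hb.
by rewrite fE big1 // => i _; rewrite (hb i) linear0.
Qed.

Lemma isoclass_sums_ann f :
  isoclass_sums f -> implied_by_ann (fun b => f b = 0).
Proof.
case=> n [j [w [jw ->]]].
have /implied_by_ann_all [F FP] : forall i, implied_by_ann (fun b => w i b = 0).
  move=> i; have [X [Xs _ Xw]] := isoclass_rep (j i).
  by apply: coef_space_ann Xs (Xw _ _).
exists F => b hb; rewrite dual_sumE big1 // => i _; exact: FP.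
Qed.

Lemma peter_weyl_semisimple : peter_weyl C -> semisimple_category C.
Proof.
case=> dualE _ V CV.
pose E := vbasis {:V}.
(* An element of B acts as zero on V as soon as the finitely many matrix
   coefficients of V in the basis E vanish on it. *)
pose zeta i : 'Hom(V, k^o) := linfun (coord E i : {linear V -> k^o}).
have /implied_by_ann_all [F FP] : forall p : 'I_(\dim {:V}) * 'I_(\dim {:V}),
    implied_by_ann (fun b => beta E`_p.1 (zeta p.2) b = 0).
  move=> p; apply: isoclass_sums_ann.
  have : dual_of_category C (beta E`_p.1 (zeta p.2)).
    exists 1%N, (fun _ => 1), (fun _ => beta E`_p.1 (zeta p.2)).
    rewrite big_ord1 scale1r; split=> // _.
    by exists V => //; apply: coef_space_beta.
  by rewrite dualE.
apply: (sum_of_simples (S := @sf_module F)); first exact: sf_simple.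
move=> U; apply: (ann_generated (s := @sf_elt F)).
  by move=> i; apply/simple_irreducible/sf_simple.
move=> b hb; apply: act_basis => i; rewrite (coord_vbasis (memvf (act V b _))).
rewrite big1 // => l _; have := FP b hb (i, l).
by rewrite /beta /= /matrix_coef lfunE /= => ->; rewrite scale0r.
Qed.

End Category.

Theorem theorem1p2 (k : fieldType) (B : bialgType k) (C : fdmodule B -> Prop)
    (hC : abelian_subcategory C) :
  semisimple_category C <-> peter_weyl C.
Proof.
split; first exact: semisimple_peter_weyl.
exact: peter_weyl_semisimple.
Qed.
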